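(* Let $u,v$ be $\lambda\mu$-terms. If $u\rightarrow_{\mu^+}^n v$, then there is $m\geq n$ such that $u^*\rightharpoonup_{\mu^{++}}^m v^*$.
   Context: $\lambda\mu$-terms: $t ::= x\mid\lambda x\,t\mid(t\;t)\mid\mu\alpha\,[\beta]t$ ($x$ $\lambda$-variables, $\alpha,\beta$ $\mu$-variables). For a $\lambda\mu$-term $u$, $u[\alpha:=^*v]$ is obtained by replacing inductively every subterm of the form $[\alpha]w$ by $[\alpha](w\;v)$. The $\lambda\mu^+$ rules are: $(c_\lambda)$ $(\lambda x\,u\;v)\rightarrow u[x:=v]$; $(c_\mu)$ $(\mu\alpha\,u\;v)\rightarrow\mu\alpha\,u[\alpha:=^*v]$; $(s_1)$ $[\alpha]\mu\beta\,u\rightarrow u[\beta:=\alpha]$; $(s_2)$ $\mu\alpha\,[\alpha]u\rightarrow u$ if $\alpha$ has no free occurrence in $u$; $(s_3)$ $\mu\alpha\,u\rightarrow\lambda x\,\mu\alpha\,u[\alpha:=^*x]$ if $u$ contains a subterm of the form $[\alpha]\lambda y\,w$ ($x$ fresh); $(\rightarrow')$ $\mu\alpha\,[\beta]u[y:=[\alpha]v]\rightarrow v$ if $y$ is free in $u$ and $\alpha$ is not free in $v$. $t\rightarrow_{\mu^+}^n t'$ means $t'$ is obtained from $t$ by applying these rules $n$ times (to subterms). $\lambda\mu^{++}$-terms: $t ::= x\mid\alpha\mid\lambda x\,t\mid\mu\alpha\,t\mid(t\;t)$. $\mathbf{id}=\lambda x\,x$. One-step reduction $\rightharpoonup$ is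 the contextual closure of: $(C_\lambda)$ $(\lambda x\,u\;v)\rightharpoonup u[x:=v]$; $(C_\mu)$ $(\mu\alpha\,u\;v)\rightharpoonup\mu\beta\,u[\alpha:=\lambda y\,(\beta\;(y\;v))]$; $(S_1)$ $((\alpha\;u)\;v)\rightharpoonup(\alpha\;u)$; $(S_2)$ $\mu\alpha\mu\beta\,u\rightharpoonup\mu\alpha\,u[\beta:=\mathbf{id}]$; $(S_3)$ $(\alpha\;(\beta\;u))\rightharpoonup(\beta\;u)$; $(S_4)$ $(\beta\;\mu\alpha\,u)\rightharpoonup u[\alpha:=\lambda y\,(\beta\;y)]$; $(S_5)$ $\mu\alpha\,u\rightharpoonup\lambda z\,\mu\beta\,u[\alpha:=\lambda y\,(\beta\;(y\;z))]$ if $u$ contains a subterm $(\alpha\;\lambda x\,v)$; $(S_6)$ $\mu\alpha\,u[y:=(\alpha\;v)]\rightharpoonup v$ if $y$ is free in $u$ and $\alpha$ not free in $v$. $t\rightharpoonup_{\mu^{++}}^m t'$ means $t'$ is obtained from $t$ by $m$ steps. The translation $t\mapsto t^*$ from $\lambda\mu$-terms to $\lambda\mu^{++}$-terms: $x^*=x$, $(\lambda x\,t)^*=\lambda x\,t^*$, $(u\;v)^*=(u^*\;v^* )$, $(\mu\alpha\,[\beta]t)^*=\mu\alpha\,(\beta\;t^* )$. *)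

(* Defs.v *)
(* Both calculi are formalized up to alpha-equivalence with de Bruijn indices:
   lambda-variables and mu-variables are two independent families of indices,
   [lam] binds index 0 of the first family and [mu] binds index 0 of the
   second.  An index pointing outside all binders is a free variable.  In the
   rules, "[a] is not free in [v]" and "[x] is fresh" are expressed by writing
   the term concerned as a shift. *)

Definition scons {A : Type} (x : A) (f : nat -> A) (n : nat) : A :=
  match n with
  | O => x
  | S k => f k
  end.

Definition up_ren (f : nat -> nat) : nat -> nat := scons 0 (fun n => S (f n)).

Inductive nsteps {A : Type} (R : A -> A -> Prop) : nat -> A -> A -> Prop :=
| nsteps_O x : nsteps R 0 x x
| nsteps_S n x y z : R x y -> nsteps R n y z -> nsteps R (S n) x z.

(** * The lambda-mu calculus *)

(* [tm_mu c] is the term (mu a c), where c is necessarily of the form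
   [cmd_named b t], that is [b]t; b = 0 refers to the a just bound. *)
Inductive tm : Type :=
| tm_var (x : nat)
| tm_lam (t : tm)
| tm_app (t u : tm)
| tm_mu (c : cmd)
with cmd : Type :=
| cmd_named (b : nat) (t : tm).

(* [f] renames the lambda-variables, [g] the mu-variables. *)
Fixpoint tm_ren (f g : nat -> nat) (t : tm) : tm :=
  match t with
  | tm_var x => tm_var (f x)
  | tm_lam t => tm_lam (tm_ren (up_ren f) g t)
  | tm_app t u => tm_app (tm_ren f g t) (tm_ren f g u)
  | tm_mu c => tm_mu (cmd_ren f (up_ren g) c)
  end
with cmd_ren (f g : nat -> nat) (c : cmd) : cmd :=
  match c with
  | cmd_named b t => cmd_named (g b) (tm_ren f g t)
  end.

Definition tm_lshift : tm -> tm := tm_ren S (fun a => a).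
Definition tm_mshift : tm -> tm := tm_ren (fun x => x) S.
Definition cmd_lshift : cmd -> cmd := cmd_ren S (fun a => a).

Definition tm_up_lam (s : nat -> tm) : nat -> tm :=
  scons (tm_var 0) (fun n => tm_lshift (s n)).
Definition tm_up_mu (s : nat -> tm) : nat -> tm := fun n => tm_mshift (s n).

(* Simultaneous capture-avoiding substitution for the lambda-variables. *)
Fixpoint tm_subst (s : nat -> tm) (t : tm) : tm :=
  match t with
  | tm_var x => s x
  | tm_lam t => tm_lam (tm_subst (tm_up_lam s) t)
  | tm_app t u => tm_app (tm_subst s t) (tm_subst s u)
  | tm_mu c => tm_mu (cmd_subst (tm_up_mu s) c)
  end
with cmd_subst (s : nat -> tm) (c : cmd) : cmd :=
  match c with
  | cmd_named b t => cmd_named b (tm_subst s t)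
  end.

(* The structural substitution t[a :=* v]: each subterm [a]w becomes
   [a](w v), inductively.  The variable a is not removed from the scope. *)
Fixpoint tm_struct (a : nat) (v : tm) (t : tm) : tm :=
  match t with
  | tm_var x => tm_var x
  | tm_lam t => tm_lam (tm_struct a (tm_lshift v) t)
  | tm_app t u => tm_app (tm_struct a v t) (tm_struct a v u)
  | tm_mu c => tm_mu (cmd_struct (S a) (tm_mshift v) c)
  end
with cmd_struct (a : nat) (v : tm) (c : cmd) : cmd :=
  match c with
  | cmd_named b t =>
      if Nat.eqb b a then cmd_named b (tm_app (tm_struct a v t) v)
      else cmd_named b (tm_struct a v t)
  end.

(* There is a subterm of the form [a](lambda y w). *)
Fixpoint tm_has_named_lam (a : nat) (t : tm) : Prop :=
  match t with
  | tm_var _ => False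
  | tm_lam t => tm_has_named_lam a t
  | tm_app t u => tm_has_named_lam a t \/ tm_has_named_lam a u
  | tm_mu c => cmd_has_named_lam (S a) c
  end
with cmd_has_named_lam (a : nat) (c : cmd) : Prop :=
  match c with
  | cmd_named b t =>
      (b = a /\ exists w, t = tm_lam w) \/ tm_has_named_lam a t
  end.

(* In u[y := [a]v] the variable y stands for [a]v, which is not a term: it may
   only occur immediately below a mu.  The terms u in which such a y may occur
   are the [ytm]s, and [ycmd_y] is the variable y; there is only one such
   variable, and it is never bound. *)
Inductive ytm : Type :=
| ytm_var (x : nat)
| ytm_lam (t : ytm)
| ytm_app (t u : ytm)
| ytm_mu (c : ycmd)
with ycmd : Type :=
| ycmd_y
| ycmd_named (b : nat) (t : ytm).

(* u[y := [a]v], capture-avoiding. *)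
Fixpoint ytm_inst (a : nat) (v : tm) (u : ytm) : tm :=
  match u with
  | ytm_var x => tm_var x
  | ytm_lam t => tm_lam (ytm_inst a (tm_lshift v) t)
  | ytm_app t u => tm_app (ytm_inst a v t) (ytm_inst a v u)
  | ytm_mu c => tm_mu (ycmd_inst (S a) (tm_mshift v) c)
  end
with ycmd_inst (a : nat) (v : tm) (c : ycmd) : cmd :=
  match c with
  | ycmd_y => cmd_named a v
  | ycmd_named b t => cmd_named b (ytm_inst a v t)
  end.

Fixpoint y_free_tm (u : ytm) : Prop :=
  match u with
  | ytm_var _ => False
  | ytm_lam t => y_free_tm t
  | ytm_app t u => y_free_tm t \/ y_free_tm u
  | ytm_mu c => y_free_cmd c
  end
with y_free_cmd (c : ycmd) : Prop :=
  match c with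
  | ycmd_y => True
  | ycmd_named _ t => y_free_tm t
  end.

Inductive tm_rule : tm -> tm -> Prop :=
| rule_c_lam u v :
    tm_rule (tm_app (tm_lam u) v) (tm_subst (scons v tm_var) u)
| rule_c_mu c v :
    tm_rule (tm_app (tm_mu c) v) (tm_mu (cmd_struct 0 (tm_mshift v) c))
| rule_s2 u :
    tm_rule (tm_mu (cmd_named 0 (tm_mshift u))) u
| rule_s3 c :
    cmd_has_named_lam 0 c ->
    tm_rule (tm_mu c) (tm_lam (tm_mu (cmd_struct 0 (tm_var 0) (cmd_lshift c))))
| rule_arrow b u v :
    y_free_tm u ->
    tm_rule (tm_mu (cmd_named b (ytm_inst 0 (tm_mshift v) u))) v.

Inductive cmd_rule : cmd -> cmd -> Prop :=
| rule_s1 a c :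
    cmd_rule (cmd_named a (tm_mu c))
             (cmd_ren (fun x => x) (scons a (fun n => n)) c).

Inductive tm_step : tm -> tm -> Prop :=
| tm_step_rule t t' : tm_rule t t' -> tm_step t t'
| tm_step_lam t t' : tm_step t t' -> tm_step (tm_lam t) (tm_lam t')
| tm_step_app_l t t' u : tm_step t t' -> tm_step (tm_app t u) (tm_app t' u)
| tm_step_app_r t u u' : tm_step u u' -> tm_step (tm_app t u) (tm_app t u')
| tm_step_mu c c' : cmd_step c c' -> tm_step (tm_mu c) (tm_mu c')
with cmd_step : cmd -> cmd -> Prop :=
| cmd_step_rule c c' : cmd_rule c c' -> cmd_step c c'
| cmd_step_named b t t' :
    tm_step t t' -> cmd_step (cmd_named b t) (cmd_named b t').

(** * The lambda-mu-++ calculus *)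

Inductive ptm : Type :=
| p_var (x : nat)
| p_mvar (a : nat)
| p_lam (t : ptm)
| p_mu (t : ptm)
| p_app (t u : ptm).

Fixpoint p_ren (f g : nat -> nat) (t : ptm) : ptm :=
  match t with
  | p_var x => p_var (f x)
  | p_mvar a => p_mvar (g a)
  | p_lam t => p_lam (p_ren (up_ren f) g t)
  | p_mu t => p_mu (p_ren f (up_ren g) t)
  | p_app t u => p_app (p_ren f g t) (p_ren f g u)
  end.

Definition p_lshift : ptm -> ptm := p_ren S (fun a => a).
Definition p_mshift : ptm -> ptm := p_ren (fun x => x) S.

(* Simultaneous capture-avoiding substitution: [s] for the lambda-variables,
   [r] for the mu-variables. *)
Fixpoint p_subst (s r : nat -> ptm) (t : ptm) : ptm :=
  match t with
  | p_var x => s x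
  | p_mvar a => r a
  | p_lam t =>
      p_lam (p_subst (scons (p_var 0) (fun n => p_lshift (s n)))
                     (fun n => p_lshift (r n)) t)
  | p_mu t =>
      p_mu (p_subst (fun n => p_mshift (s n))
                    (scons (p_mvar 0) (fun n => p_mshift (r n))) t)
  | p_app t u => p_app (p_subst s r t) (p_subst s r u)
  end.

(* u[x := v] and u[a := v] for the variable of index 0; the other variables of
   the same family move down by one. *)
Definition p_lsubst (v u : ptm) : ptm := p_subst (scons v p_var) p_mvar u.
Definition p_msubst (v u : ptm) : ptm := p_subst p_var (scons v p_mvar) u.

(* u[a := v] placed below a new binder (mu b): index 0 now denotes b, which may
   occur in v, and the variables other than a keep their index. *)
Definition p_msubst_mu (v u : ptm) : ptm :=
  p_subst p_var (scons v (fun n => p_mvar (S n))) u.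

Definition p_id : ptm := p_lam (p_var 0).

Fixpoint p_lfree (x : nat) (t : ptm) : Prop :=
  match t with
  | p_var y => y = x
  | p_mvar _ => False
  | p_lam t => p_lfree (S x) t
  | p_mu t => p_lfree x t
  | p_app t u => p_lfree x t \/ p_lfree x u
  end.

(* There is a subterm of the form (a (lambda x v)). *)
Fixpoint p_has_app_lam (a : nat) (t : ptm) : Prop :=
  match t with
  | p_var _ | p_mvar _ => False
  | p_lam t => p_has_app_lam a t
  | p_mu t => p_has_app_lam (S a) t
  | p_app t u =>
      (t = p_mvar a /\ exists w, u = p_lam w)
      \/ p_has_app_lam a t \/ p_has_app_lam a u
  end.

Inductive p_rule : ptm -> ptm -> Prop :=
| rule_C_lam u v : p_rule (p_app (p_lam u) v) (p_lsubst v u)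
| rule_C_mu u v :
    p_rule (p_app (p_mu u) v)
           (p_mu (p_msubst_mu
                    (p_lam (p_app (p_mvar 0)
                              (p_app (p_var 0) (p_lshift (p_mshift v)))))
                    u))
| rule_S1 a u v :
    p_rule (p_app (p_app (p_mvar a) u) v) (p_app (p_mvar a) u)
| rule_S2 u : p_rule (p_mu (p_mu u)) (p_mu (p_msubst p_id u))
| rule_S3 a b u :
    p_rule (p_app (p_mvar a) (p_app (p_mvar b) u)) (p_app (p_mvar b) u)
| rule_S4 b u :
    p_rule (p_app (p_mvar b) (p_mu u))
           (p_msubst (p_lam (p_app (p_mvar b) (p_var 0))) u)
| rule_S5 u :
    p_has_app_lam 0 u ->
    p_rule (p_mu u)
           (p_lam (p_mu (p_msubst_mu
                           (p_lam (p_app (p_mvar 0)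
                                     (p_app (p_var 0) (p_var 1))))
                           (p_lshift u))))
| rule_S6 u v :
    p_lfree 0 u ->
    p_rule (p_mu (p_lsubst (p_app (p_mvar 0) (p_mshift v)) u)) v.

Inductive p_step : ptm -> ptm -> Prop :=
| p_step_rule t t' : p_rule t t' -> p_step t t'
| p_step_lam t t' : p_step t t' -> p_step (p_lam t) (p_lam t')
| p_step_mu t t' : p_step t t' -> p_step (p_mu t) (p_mu t')
| p_step_app_l t t' u : p_step t t' -> p_step (p_app t u) (p_app t' u)
| p_step_app_r t u u' : p_step u u' -> p_step (p_app t u) (p_app t u').

(** * The translation *)

Fixpoint tr (t : tm) : ptm :=
  match t with
  | tm_var x => p_var x
  | tm_lam t => p_lam (tr t)
  | tm_app t u => p_app (tr t) (tr u)
  | tm_mu c => p_mu (tr_cmd c)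
  end
with tr_cmd (c : cmd) : ptm :=
  match c with
  | cmd_named b t => p_app (p_mvar b) (tr t)
  end.

(* Main.v *)
(* Each rule of the lambda-mu-+ calculus is simulated by one step of the
   lambda-mu-++ calculus, followed for (c_mu), (s1) and (s3) by
   beta-reductions: the ++-rule replaces the mu-variable a by an abstraction,
   and contracting the redexes created at the former occurrences of (a w)
   yields the structural substitution or the renaming.  Both (s2) and (->') are
   single instances of (S6), the former with u := y. *)

Require Import Defs.
From Stdlib Require Import PeanoNat Lia.

(** * Induction principles for the mutual syntax and reductions *)

(** Since [cmd] has a single constructor, the mutual induction collapses to one predicate on
    terms. *)
Lemma tm_named_ind (P : tm -> Prop)
  (Hvar : forall x, P (tm_var x))
  (Hlam : forall t, P t -> P (tm_lam t))
  (Happ : forall t u, P t -> P u -> P (tm_app t u))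
  (Hmu : forall b t, P t -> P (tm_mu (cmd_named b t))) :
  forall t, P t.
Proof.
  fix IH 1. intros [x | t | t u | [b t]].
  - apply Hvar.
  - apply Hlam, IH.
  - apply Happ; apply IH.
  - apply Hmu, IH.
Qed.

Lemma ytm_named_ind (P : ytm -> Prop)
  (Hvar : forall x, P (ytm_var x))
  (Hlam : forall t, P t -> P (ytm_lam t))
  (Happ : forall t u, P t -> P u -> P (ytm_app t u))
  (Hy : P (ytm_mu ycmd_y))
  (Hmu : forall b t, P t -> P (ytm_mu (ycmd_named b t))) :
  forall t, P t.
Proof.
  fix IH 1. intros [x | t | t u | [ | b t]].
  - apply Hvar.
  - apply Hlam, IH.
  - apply Happ; apply IH.
  - apply Hy.
  - apply Hmu, IH.
Qed.

Scheme tm_step_mut := Induction for tm_step Sort Prop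
  with cmd_step_mut := Induction for cmd_step Sort Prop.
Combined Scheme tm_cmd_step_ind from tm_step_mut, cmd_step_mut.

(** * Reduction in at least a given number of steps *)

(** Only a lower bound is tracked, because the number of beta steps after a simulated rule depends
    on the occurrences of the mu-variable. [p_reach 0] is reflexive-transitive reduction. *)
Definition p_reach (k : nat) (t u : ptm) : Prop :=
  exists m, k <= m /\ nsteps p_step m t u.

Lemma nsteps_trans {A : Type} (R : A -> A -> Prop) m n x y z :
  nsteps R m x y -> nsteps R n y z -> nsteps R (m + n) x z.
Proof.
  induction 1; intros; simpl; trivial.
  econstructor; eauto.
Qed.

Lemma nsteps_map {A : Type} (R : A -> A -> Prop) (f : A -> A) n x y :
  (forall a b, R a b -> R (f a) (f b)) ->
  nsteps R n x y -> nsteps R n (f x) (f y).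
Proof. intros Hf; induction 1; econstructor; eauto. Qed.

Lemma p_reach_refl t : p_reach 0 t t.
Proof. exists 0; split; [lia | constructor]. Qed.

Lemma p_reach_trans j k t u v :
  p_reach j t u -> p_reach k u v -> p_reach (j + k) t v.
Proof.
  intros [m [Hm Htu]] [n [Hn Huv]].
  exists (m + n); split; [lia | eapply nsteps_trans; eauto].
Qed.

Lemma p_reach_weaken j k t u : j <= k -> p_reach k t u -> p_reach j t u.
Proof. intros Hjk [m [Hm H]]; exists m; split; [lia | trivial]. Qed.

Lemma p_reach_rule t u : p_rule t u -> p_reach 1 t u.
Proof.
  intros H; exists 1; split; [lia | ].
  econstructor; [apply p_step_rule, H | constructor].
Qed.

Lemma p_reach_map (f : ptm -> ptm) k t u :
  (forall a b, p_step a b -> p_step (f a) (f b)) ->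
  p_reach k t u -> p_reach k (f t) (f u).
Proof. intros Hf [m [Hm H]]; exists m; split; [trivial | now apply nsteps_map]. Qed.

Lemma p_reach_lam k t u : p_reach k t u -> p_reach k (p_lam t) (p_lam u).
Proof. apply p_reach_map, p_step_lam. Qed.

Lemma p_reach_mu k t u : p_reach k t u -> p_reach k (p_mu t) (p_mu u).
Proof. apply p_reach_map, p_step_mu. Qed.

Lemma p_reach_app_l k t t' u :
  p_reach k t t' -> p_reach k (p_app t u) (p_app t' u).
Proof. apply (p_reach_map (fun t => p_app t u)); intros; now apply p_step_app_l. Qed.

Lemma p_reach_app_r k t u u' :
  p_reach k u u' -> p_reach k (p_app t u) (p_app t u').
Proof. apply p_reach_map; intros; now apply p_step_app_r. Qed.

Lemma p_reach_app t t' u u' :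
  p_reach 0 t t' -> p_reach 0 u u' -> p_reach 0 (p_app t u) (p_app t' u').
Proof.
  intros Ht Hu.
  apply (p_reach_trans 0 0 _ (p_app t' u)).
  - now apply p_reach_app_l.
  - now apply p_reach_app_r.
Qed.

(** * Renaming, substitution and the translation *)

(* The hypotheses on renamings and substitutions below are pointwise so that
   they pass under binders without functional extensionality. *)

Lemma p_ren_ren_comm t : forall f g f1 g1 f2 g2 f3 g3,
  (forall x, f1 (f x) = f3 (f2 x)) -> (forall a, g1 (g a) = g3 (g2 a)) ->
  p_ren f1 g1 (p_ren f g t) = p_ren f3 g3 (p_ren f2 g2 t).
Proof.
  induction t; intros * Hf Hg; simpl.
  - now rewrite Hf.
  - now rewrite Hg.
  - f_equal. apply IHt; trivial. intros [|x]; simpl; auto.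
  - f_equal. apply IHt; trivial. intros [|x]; simpl; auto.
  - f_equal; auto.
Qed.

Lemma p_subst_ren_cancel t : forall s r f g,
  (forall x, s (f x) = p_var x) -> (forall a, r (g a) = p_mvar a) ->
  p_subst s r (p_ren f g t) = t.
Proof.
  induction t; intros * Hs Hr; simpl; auto.
  - f_equal. apply IHt; [intros [|x] | intros a]; simpl; trivial;
      now rewrite ?Hs, ?Hr.
  - f_equal. apply IHt; [intros x | intros [|a]]; simpl; trivial;
      now rewrite ?Hs, ?Hr.
  - f_equal; auto.
Qed.

Lemma tr_ren t : forall f g, tr (tm_ren f g t) = p_ren f g (tr t).
Proof.
  induction t using tm_named_ind; intros; simpl; f_equal; auto.
  f_equal; auto.
Qed.

Lemma tr_subst t : forall s s' r,
  (forall x, s' x = tr (s x)) -> (forall a, r a = p_mvar a) ->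
  p_subst s' r (tr t) = tr (tm_subst s t).
Proof.
  induction t using tm_named_ind; intros * Hs Hr; simpl; auto.
  - f_equal. apply IHt; [intros [|x] | intros a]; simpl; trivial.
    + rewrite Hs. symmetry. apply tr_ren.
    + now rewrite Hr.
  - f_equal; auto.
  - assert (Hr' : forall a,
      scons (p_mvar 0) (fun n => p_mshift (r n)) a = p_mvar a)
      by (intros [|a]; simpl; now rewrite ?Hr).
    rewrite Hr'. do 2 f_equal. apply IHt; trivial.
    intros x; simpl. rewrite Hs. symmetry. apply tr_ren.
Qed.

(** * Structural substitution *)

(** For [b = a] the substitution creates a redex [((lambda y. a (y v)) w)], and one beta step yields
    [(a (w v))]. This serves both below a [mu] and for a command on its own. *)
Lemma tr_struct_named b t a v s r :
  r a = p_lam (p_app (p_mvar a) (p_app (p_var 0) (p_lshift (tr v)))) ->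
  (forall c, c <> a -> r c = p_mvar c) ->
  p_reach 0 (p_subst s r (tr t)) (tr (tm_struct a v t)) ->
  p_reach 0 (p_subst s r (tr_cmd (cmd_named b t)))
            (tr_cmd (cmd_struct a v (cmd_named b t))).
Proof.
  intros Ha Hc Ht; simpl.
  destruct (Nat.eqb_spec b a) as [-> | Hba]; simpl.
  - rewrite Ha.
    apply (p_reach_trans 0 0 _ _ _ (p_reach_app_r _ _ _ _ Ht)).
    apply (p_reach_weaken 0 1); [lia | ].
    (* The target's [tr v] is written as a substituted shift, so that the target becomes literally
       the beta contractum. *)
    rewrite <- (p_subst_ren_cancel (tr v) (scons (tr (tm_struct a v t)) p_var)
                  p_mvar S (fun c => c)) at 2 by trivial.
    apply p_reach_rule, rule_C_lam.
  - rewrite Hc by trivial. now apply p_reach_app_r.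
Qed.

Lemma tr_struct t : forall a v s r,
  (forall x, s x = p_var x) ->
  r a = p_lam (p_app (p_mvar a) (p_app (p_var 0) (p_lshift (tr v)))) ->
  (forall b, b <> a -> r b = p_mvar b) ->
  p_reach 0 (p_subst s r (tr t)) (tr (tm_struct a v t)).
Proof.
  induction t using tm_named_ind; intros a v s r Hs Ha Hb.
  - simpl. rewrite Hs. apply p_reach_refl.
  - apply p_reach_lam, IHt.
    + intros [|x]; simpl; now rewrite ?Hs.
    + rewrite Ha. unfold tm_lshift; rewrite tr_ren.
      unfold p_lshift; simpl. do 3 f_equal. now apply p_ren_ren_comm.
    + intros b Hba. now rewrite Hb.
  - apply p_reach_app; auto.
  - set (r' := scons (p_mvar 0) (fun n => p_mshift (r n))).
    assert (Ha' : r' (S a) = p_lam (p_app (p_mvar (S a))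
                    (p_app (p_var 0) (p_lshift (tr (tm_mshift v)))))).
    { simpl. rewrite Ha. unfold tm_mshift; rewrite tr_ren.
      unfold p_mshift, p_lshift; simpl. do 3 f_equal.
      apply p_ren_ren_comm; trivial. }
    assert (Hb' : forall c, c <> S a -> r' c = p_mvar c).
    { intros [|c] Hc; simpl; trivial. rewrite Hb; [trivial | lia]. }
    apply p_reach_mu, tr_struct_named, IHt; trivial.
    intros x. now rewrite Hs.
Qed.

Lemma tr_struct_cmd c v :
  p_reach 0
    (p_msubst_mu
       (p_lam (p_app (p_mvar 0) (p_app (p_var 0) (p_lshift (tr v))))) (tr_cmd c))
    (tr_cmd (cmd_struct 0 v c)).
Proof.
  set (w := p_lam _).
  assert (Hb : forall b, b <> 0 ->
            scons w (fun n => p_mvar (S n)) b = p_mvar b)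
    by (intros [|b] ?; [lia | trivial]).
  destruct c as [b t]. apply tr_struct_named, tr_struct; trivial.
Qed.

(** * Renaming of mu-variables up to eta *)

(* [scons a id] in (s1) identifies the bound variable with a, whereas (S4)
   replaces the bound variable by the eta-expansion of a. *)
Lemma tr_mren_eta_named b t f g s r :
  (forall c, r c = p_mvar (g c) \/
             r c = p_lam (p_app (p_mvar (g c)) (p_var 0))) ->
  p_reach 0 (p_subst s r (tr t)) (tr (tm_ren f g t)) ->
  p_reach 0 (p_subst s r (tr_cmd (cmd_named b t)))
            (tr_cmd (cmd_ren f g (cmd_named b t))).
Proof.
  intros Hr Ht; simpl.
  apply (p_reach_trans 0 0 _ _ _ (p_reach_app_r _ _ _ _ Ht)).
  destruct (Hr b) as [-> | ->].
  - apply p_reach_refl.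
  - apply (p_reach_weaken 0 1); [lia | ].
    apply p_reach_rule, rule_C_lam.
Qed.

(** The disjunction passes under binders: a newly bound mu-variable is kept as a variable, and
    shifting preserves both forms. Each eta-expanded head costs one beta step. *)
Lemma tr_mren_eta t : forall f g s r,
  (forall x, f x = x) -> (forall x, s x = p_var x) ->
  (forall b, r b = p_mvar (g b) \/
             r b = p_lam (p_app (p_mvar (g b)) (p_var 0))) ->
  p_reach 0 (p_subst s r (tr t)) (tr (tm_ren f g t)).
Proof.
  induction t using tm_named_ind; intros f g s r Hf Hs Hr.
  - simpl. rewrite Hs, Hf. apply p_reach_refl.
  - apply p_reach_lam, IHt.
    + intros [|x]; simpl; now rewrite ?Hf.
    + intros [|x]; simpl; now rewrite ?Hs.
    + intros b. destruct (Hr b) as [-> | ->]; auto.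
  - apply p_reach_app; auto.
  - set (r' := scons (p_mvar 0) (fun n => p_mshift (r n))).
    assert (Hr' : forall b, r' b = p_mvar (up_ren g b) \/
              r' b = p_lam (p_app (p_mvar (up_ren g b)) (p_var 0))).
    { intros [|c]; simpl; auto. destruct (Hr c) as [-> | ->]; auto. }
    apply p_reach_mu, tr_mren_eta_named, IHt; trivial.
    intros x. now rewrite Hs.
Qed.

(** * Side condition of (s3) *)

Lemma tr_has_named_lam t : forall a,
  tm_has_named_lam a t -> p_has_app_lam a (tr t).
Proof.
  induction t using tm_named_ind; simpl; auto.
  - intros a [H | H]; auto.
  - intros a [[-> [w ->]] | H]; simpl; eauto.
Qed.

Lemma tr_cmd_has_named_lam c a :
  cmd_has_named_lam a c -> p_has_app_lam a (tr_cmd c).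
Proof.
  destruct c as [b t].
  intros [[-> [w ->]] | H]; simpl; eauto using tr_has_named_lam.
Qed.

(** * Instances [u[y := [a]v]] *)

(* [f] renames the lambda-variables of the term around the variable y, which
   itself becomes the ordinary lambda-variable [y]. *)
Fixpoint ytr (f : nat -> nat) (y : nat) (u : ytm) : ptm :=
  match u with
  | ytm_var x => p_var (f x)
  | ytm_lam t => p_lam (ytr (up_ren f) (S y) t)
  | ytm_app t u => p_app (ytr f y t) (ytr f y u)
  | ytm_mu ycmd_y => p_mu (p_var y)
  | ytm_mu (ycmd_named b t) => p_mu (p_app (p_mvar b) (ytr f y t))
  end.

Lemma ytr_lfree u : forall f y, y_free_tm u -> p_lfree y (ytr f y u).
Proof.
  induction u using ytm_named_ind; simpl; auto.
  - contradiction.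
  - intros f y [H | H]; auto.
Qed.

(** Turns the substitution of a command for the special variable into an ordinary substitution of
    [(a v)], the form demanded by (S6). The condition on [s] and [f] says that [s] undoes the
    renaming around [y]. *)
Lemma tr_inst u : forall f y a v s r,
  (forall x, s (f x) = p_var x) -> s y = p_app (p_mvar a) (tr v) ->
  (forall b, r b = p_mvar b) ->
  tr (ytm_inst a v u) = p_subst s r (ytr f y u).
Proof.
  induction u using ytm_named_ind; intros f y a v s r Hs Hy Hr; simpl.
  - now rewrite Hs.
  - f_equal. apply IHu; simpl.
    + intros [|x]; simpl; now rewrite ?Hs.
    + rewrite Hy. unfold tm_lshift; now rewrite tr_ren.
    + intros b. now rewrite Hr.
  - f_equal; auto.
  - rewrite Hy. unfold tm_mshift; now rewrite tr_ren.
  - assert (Hr' : forall b,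
      scons (p_mvar 0) (fun n => p_mshift (r n)) b = p_mvar b)
      by (intros [|c]; simpl; now rewrite ?Hr).
    rewrite Hr'. do 2 f_equal. apply IHu; trivial.
    + intros x. now rewrite Hs.
    + rewrite Hy. unfold tm_mshift; now rewrite tr_ren.
Qed.

(** * Simulation of rules and steps *)

Lemma tr_tm_rule t t' : tm_rule t t' -> p_reach 1 (tr t) (tr t').
Proof.
  destruct 1 as [u v | c v | u | c H | b u v H]; cbn [tr tr_cmd].
  - rewrite <- (tr_subst u _ (scons (tr v) p_var) p_mvar).
    + apply p_reach_rule, rule_C_lam.
    + intros [|x]; trivial.
    + trivial.
  - eapply (p_reach_trans 1 0); [apply p_reach_rule, rule_C_mu | ].
    apply p_reach_mu. unfold p_mshift; rewrite <- tr_ren.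
    apply tr_struct_cmd.
  - unfold tm_mshift; rewrite tr_ren.
    apply p_reach_rule, (rule_S6 (p_var 0)). reflexivity.
  - eapply (p_reach_trans 1 0); [apply p_reach_rule, rule_S5 | ].
    + now apply tr_cmd_has_named_lam.
    + apply p_reach_lam, p_reach_mu.
      replace (p_lshift (tr_cmd c)) with (tr_cmd (cmd_lshift c)).
      (* The fresh variable has index 0 below the new lambda, hence index 1 inside the abstraction
         substituted by (S5). *)
      * apply (tr_struct_cmd _ (tm_var 0)).
      * destruct c as [b t]. simpl. rewrite tr_ren. reflexivity.
  (* Index 0 is reserved for [y] and the other lambda-variables move up by one; the substitution
     moves them back. *)
  - rewrite (tr_inst u S 0 0 _
               (scons (p_app (p_mvar 0) (p_mshift (tr v))) p_var) p_mvar);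
      trivial.
    + apply p_reach_rule, (rule_S6 (p_app (p_mvar b) (ytr S 0 u))).
      right. now apply ytr_lfree.
    + unfold tm_mshift. now rewrite tr_ren.
Qed.

Lemma tr_cmd_rule c c' : cmd_rule c c' -> p_reach 1 (tr_cmd c) (tr_cmd c').
Proof.
  destruct 1 as [a [b t]].
  eapply (p_reach_trans 1 0); [apply p_reach_rule, rule_S4 | ].
  assert (Hr : forall c,
    let r := scons (p_lam (p_app (p_mvar a) (p_var 0))) p_mvar in
    let g := scons a (fun n => n) in
    r c = p_mvar (g c) \/ r c = p_lam (p_app (p_mvar (g c)) (p_var 0)))
    by (intros [|c]; simpl; auto).
  apply tr_mren_eta_named, tr_mren_eta; trivial.
Qed.

(** Every context translates to a context, [[b]] becoming the argument position of an application,
    so simulating the rules suffices. *)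
Lemma tr_step :
  (forall t t', tm_step t t' -> p_reach 1 (tr t) (tr t')) /\
  (forall c c', cmd_step c c' -> p_reach 1 (tr_cmd c) (tr_cmd c')).
Proof.
  apply tm_cmd_step_ind; intros; simpl.
  - now apply tr_tm_rule.
  - now apply p_reach_lam.
  - now apply p_reach_app_l.
  - now apply p_reach_app_r.
  - now apply p_reach_mu.
  - now apply tr_cmd_rule.
  - now apply p_reach_app_r.
Qed.

Theorem theorem3 (u v : tm) (n : nat) (h : nsteps tm_step n u v) :
  exists m : nat, n <= m /\ nsteps p_step m (tr u) (tr v).
Proof.
  induction h as [x | n x y z Hxy _ IH].
  - apply p_reach_refl.
  - exact (p_reach_trans 1 n _ _ _ (proj1 tr_step x y Hxy) IH).
Qed.
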